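(* Assume $\phi^*(t)$ has finite second moment under the law $p_T$ of $t$ and that the source distribution puts no mass on cell boundaries. Any locally $\varepsilon$-optimal $K$-partition of $\mathcal{T}$ with all cells of positive probability satisfies the Lloyd–Max stationarity conditions applied to $\phi^*(t)$: nearest-neighbour cells in $\phi^*$-space (each $t$ is assigned to a category $k$ whose reconstruction point $\phi(k)$ is nearest to $\phi^*(t)$ in Euclidean distance) and centroid means $\phi(k)=\mathbb{E}[\phi^*(t)\mid c(t)=k]$. These conditions are necessary, not sufficient.
   Context: Types $t$ take values in $\mathcal{T}\subseteq\mathbb{R}^d$ with distribution $p_T$. A utility $U:\mathcal{T}\times\mathbb{R}^r\to\mathbb{R}$ satisfies $-\beta_U I\preceq\nabla^2_{rr}U(t,r)\preceq-\alpha I$ for all $(t,r)$, with constants $0<\alpha\le\beta_U$, and $\phi^*(t)=\arg\max_r U(t,r)\in\mathbb{R}^r$ is the oracle allocation. A $K$-partition of $\mathcal{T}$ is given by a category map $c:\mathcal{T}\to\{1,\dots,K\}$, whose cells are the sets $c^{-1}(k)$; it induces the category allocation $\phi(k)=\mathbb{E}[\phi^*(t)\mid c(t)=k]$ and the within-category variance $\varepsilon=\mathbb{E}[\|\phi^*(t)-\phi(c(t))\|^2]$. ''Locally $\varepsilon$-optimal'' refers to local optimality in the problem $\min_c\mathbb{E}[\|\phi^*(t)-\phi(c(t))\|^2]$ over $K$-partitions with conditional-mean centroids.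
   Formalization: Nearest-neighbour assignment is proved for almost every t, not each t (moving one null point to a far cell changes no mean or variance); locally optimal is read as: no recategorisation of types inside a single ball of some fixed radius lowers the variance. *)

(* Defs.v *)
From HB Require Import structures.
From mathcomp Require Import all_boot all_order all_algebra.
From mathcomp Require Import all_classical all_reals all_analysis.

Set Implicit Arguments.
Unset Strict Implicit.
Unset Printing Implicit Defensive.

Import Order.TTheory GRing.Theory Num.Theory.
Import numFieldNormedType.Exports.

Local Open Scope classical_set_scope.
Local Open Scope ring_scope.

(* R^d with its Borel sigma-algebra; the carrier is convertible to 'rV[R]_d. *)
Notation borel_rV R d := (g_sigma_algebraType (@open 'rV[R]_d)).

(* The library norm `|x| on 'rV[R]_r is the sup norm, hence this definition. *)
Definition enorm (R : realType) (r : nat) (x : 'rV[R]_r) : R :=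
  Num.sqrt (\sum_(j < r) x 0 j ^+ 2).

Definition gradient (R : realType) (r : nat) (f : 'rV[R]_r -> R)
    (x : 'rV[R]_r) : 'rV[R]_r :=
  \row_(j < r) 'D_(delta_mx 0 j) f x.

Definition hessian (R : realType) (r : nat) (f : 'rV[R]_r -> R)
    (x : 'rV[R]_r) : 'M[R]_r :=
  jacobian (gradient f) x.

Definition twice_differentiable (R : realType) (r : nat)
    (f : 'rV[R]_r -> R) : Prop :=
  (forall x, differentiable f x) /\ (forall x, differentiable (gradient f) x).

Definition loewner_le (R : realType) (r : nat) (A B : 'M[R]_r) : Prop :=
  forall v : 'rV[R]_r, 0 <= (v *m (B - A) *m v^T) 0 0.

Definition utility_bounds (R : realType) (d r : nat) (T : set 'rV[R]_d)
    (U : 'rV[R]_d -> 'rV[R]_r -> R) (alpha betaU : R) : Prop :=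
  [/\ 0 < alpha, alpha <= betaU &
      forall t, T t -> twice_differentiable (U t) /\
        forall x, loewner_le (- betaU)%:M (hessian (U t) x) /\
                  loewner_le (hessian (U t) x) (- alpha)%:M].

(* A maximiser over R^r is unique under [utility_bounds]. *)
Definition oracle_allocation (R : realType) (d r : nat) (T : set 'rV[R]_d)
    (U : 'rV[R]_d -> 'rV[R]_r -> R) (phis : 'rV[R]_d -> 'rV[R]_r) : Prop :=
  forall t, T t -> forall x, U t x <= U t (phis t).

Definition type_distribution (R : realType) (d : nat) (T : set 'rV[R]_d)
    (P : probability (borel_rV R d) R) : Prop :=
  measurable (T : set (borel_rV R d)) /\ P T = 1%E.

Definition finite_second_moment (R : realType) (d r : nat)
    (T : set 'rV[R]_d) (P : probability (borel_rV R d) R)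
    (phis : 'rV[R]_d -> 'rV[R]_r) : Prop :=
  measurable_fun (T : set (borel_rV R d))
    (phis : borel_rV R d -> borel_rV R r) /\
  (\int[P]_(t in T) (enorm (phis t) ^+ 2)%:E < +oo)%E.

(* Category maps are total functions on R^d; only their values on T matter. *)
Definition cell (R : realType) (d K : nat) (T : set 'rV[R]_d)
    (c : 'rV[R]_d -> 'I_K) (k : 'I_K) : set 'rV[R]_d :=
  [set t | T t /\ c t = k].

Definition K_partition (R : realType) (d K : nat) (T : set 'rV[R]_d)
    (c : 'rV[R]_d -> 'I_K) : Prop :=
  forall k, measurable (cell T c k : set (borel_rV R d)).

Definition positive_cells (R : realType) (d K : nat) (T : set 'rV[R]_d)
    (P : probability (borel_rV R d) R) (c : 'rV[R]_d -> 'I_K) : Prop :=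
  forall k, (0 < P (cell T c k))%E.

(* Topological boundary of a subset A of T, relative to the subspace T. *)
Definition boundary_in (R : realType) (d : nat) (T A : set 'rV[R]_d) :
    set 'rV[R]_d :=
  T `&` closure A `&` closure (T `\` A).

Definition null_cell_boundaries (R : realType) (d K : nat)
    (T : set 'rV[R]_d) (P : probability (borel_rV R d) R)
    (c : 'rV[R]_d -> 'I_K) : Prop :=
  forall k, P (boundary_in T (cell T c k)) = 0%E.

(* E[phis t | c t = k]; it is 0 by convention on a null cell, where its value
   does not affect [within_variance]. *)
Definition category_allocation (R : realType) (d r K : nat)
    (T : set 'rV[R]_d) (P : probability (borel_rV R d) R)
    (phis : 'rV[R]_d -> 'rV[R]_r) (c : 'rV[R]_d -> 'I_K) (k : 'I_K) :
    'rV[R]_r :=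
  \row_(j < r) ((\int[P]_(t in cell T c k) phis t 0 j) /
                fine (P (cell T c k))).

Definition within_variance (R : realType) (d r K : nat)
    (T : set 'rV[R]_d) (P : probability (borel_rV R d) R)
    (phis : 'rV[R]_d -> 'rV[R]_r) (c : 'rV[R]_d -> 'I_K) : \bar R :=
  (\int[P]_(t in T)
     (enorm (phis t - category_allocation T P phis c (c t)) ^+ 2)%:E)%E.

(* Local minimality of the within-category variance, each competitor being
   evaluated at its own conditional means.  The neighbours of c are the
   partitions that recategorise only types lying in one ball of radius delta.
   If P has no atom, the mass of a ball tends to 0 with its radius, uniformly
   in the centre, so every local minimiser for the distance P(c <> c') is one
   in the present sense.  If P has atoms, that distance would make
   every partition of a finitely supported P a local minimiser, whereas here
   the neighbours include the recategorisation of any single type. *)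
Definition locally_optimal (R : realType) (d r K : nat)
    (T : set 'rV[R]_d) (P : probability (borel_rV R d) R)
    (phis : 'rV[R]_d -> 'rV[R]_r) (c : 'rV[R]_d -> 'I_K) : Prop :=
  exists2 delta : R, 0 < delta &
    forall (c' : 'rV[R]_d -> 'I_K) (t0 : 'rV[R]_d),
      K_partition T c' ->
      [set t | T t /\ c' t <> c t] `<=` ball t0 delta ->
      (within_variance T P phis c <= within_variance T P phis c')%E.

(* The nearest-neighbour condition is almost sure: modifying c on a null set
   changes neither its conditional means nor its variance. *)
Definition lloyd_max (R : realType) (d r K : nat)
    (T : set 'rV[R]_d) (P : probability (borel_rV R d) R)
    (phis : 'rV[R]_d -> 'rV[R]_r) (c : 'rV[R]_d -> 'I_K)
    (q : 'I_K -> 'rV[R]_r) : Prop :=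
  {ae P, forall t, T t ->
     forall k, enorm (phis t - q (c t)) <= enorm (phis t - q k)} /\
  (forall k, q k = category_allocation T P phis c k).

(* Main.v *)
(* Necessity.  With the centres q held fixed at the conditional means of c,
   suppose that the types of cell j strictly nearer to q k than to q j have
   positive mass.  So does their part S in some ball of radius delta, because
   countably many such balls cover R^d.  Reassigning S to category k strictly
   lowers the mean squared distance to the fixed centres, and passing to the
   conditional means of the new partition lowers it further, since a mean
   minimises the squared deviation on its cell; this contradicts local
   optimality.

   Non-sufficiency.  Take the uniform law on the types 0, 2, 3 of R, with
   oracle allocation the identity and cells {0, 2}, {3}.  The centroids are 1
   and 3, and the type 2 is equidistant from them, so the partition is
   stationary; moving that single type to the other category lowers the
   variance from 2/3 to at most 1/3, the cost for the centres 0 and 3. *)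

Require Import Defs.
From HB Require Import structures.
From mathcomp Require Import all_boot all_order all_algebra.
From mathcomp Require Import all_classical all_reals all_analysis.
From mathcomp Require Import measurable_realfun ring lra.

Set Implicit Arguments.
Unset Strict Implicit.
Unset Printing Implicit Defensive.

Import Order.TTheory GRing.Theory Num.Theory.
Import numFieldNormedType.Exports.

Local Open Scope classical_set_scope.
Local Open Scope ring_scope.

(** * Means and centroids *)

(** Domination by [1 + f ^+ 2], whose constant term is integrable because [P] is finite. *)
Lemma integrable_of_sqr d (X : measurableType d) (R : realType)
    (P : probability X R) (A : set X) (f : X -> R) :
  measurable A -> measurable_fun A f ->
  P.-integrable A (EFin \o (fun x => f x ^+ 2)) ->
  P.-integrable A (EFin \o f).
Proof.
move=> mA mf if2.
have i1 : P.-integrable A (EFin \o cst 1).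
  by apply: finite_measure_integrable_cst.
apply: le_integrable (integrableD mA i1 if2) => //.
  exact/measurable_EFinP.
move=> x Ax /=; rewrite lee_fin.
have f0 := sqr_ge0 (f x).
rewrite [leRHS]ger0_norm; last by rewrite addr_ge0.
have := sqr_ge0 (`|f x| - 1); have := real_normK (num_real (f x)).
by move=> <-; have := normr_ge0 (f x); nra.
Qed.

(** With [m] the mean of [f] on [A], the right side exceeds the left by exactly
    [(m - a) ^+ 2 * fine (P A)]. *)
Lemma Rintegral_mean_min d (X : measurableType d) (R : realType)
    (P : probability X R) (A : set X) (f : X -> R) (a : R) :
  measurable A -> measurable_fun A f ->
  P.-integrable A (EFin \o (fun x => f x ^+ 2)) ->
  (\int[P]_(x in A) ((f x - (\int[P]_(y in A) f y) / fine (P A)) ^+ 2)%:E <=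
   \int[P]_(x in A) ((f x - a) ^+ 2)%:E)%E.
Proof.
move=> mA mf if2; set m := _ / _.
have i_f := integrable_of_sqr mA mf if2.
have ic (b : R) : P.-integrable A (EFin \o cst b).
  by apply: finite_measure_integrable_cst.
have isq b : P.-integrable A (EFin \o (fun x => (f x - b) ^+ 2)).
  apply: (eq_integrable mA ((EFin \o (fun x => (f x ^+ 2)%R)) \+
    ((fun x => (- (2 * b))%R%:E * (EFin \o f) x) \+ (EFin \o cst (b ^+ 2)%R)))%E).
    by move=> x _ /=; rewrite -EFinM -!EFinD; congr EFin; ring.
  by do 2 apply: integrableD => //; exact: integrableZl.
have sqE b : (\int[P]_(x in A) ((f x - b) ^+ 2)%:E)%E =
    (\int[P]_(x in A) (f x - b) ^+ 2)%:E.
  by rewrite /Rintegral fineK//; exact: (integrable_fin_num mA (isq b)).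
rewrite !sqE lee_fin -subr_ge0 -RintegralB//.
(* The squares of [f] cancel, leaving an affine function of [f], so only its first moment enters. *)
have -> : \int[P]_(x in A) ((f x - a) ^+ 2 - (f x - m) ^+ 2) =
    \int[P]_(x in A) ((2 * (m - a)) * f x + (a ^+ 2 - m ^+ 2)).
  by apply: eq_Rintegral => x _; ring.
rewrite (RintegralD mA (integrableZl mA (2 * (m - a)) i_f) (ic _)).
rewrite RintegralZl// Rintegral_cst//.
(* On a null set [m] is 0 by the convention on division; every integral vanishes, so its value is
   immaterial. *)
set p := fine (P A); have [p0|p0] := eqVneq p 0.
  have -> : \int[P]_(x in A) f x = 0.
    have PA0 : P A = 0%E.
      by rewrite -[LHS]fineK ?fin_num_measure// -/p p0.
    by rewrite /Rintegral null_set_integral//; exact/measurable_EFinP.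
  by rewrite p0 !mulr0 addr0.
have -> : \int[P]_(x in A) f x = m * p by rewrite /m -/p divfK.
have pge0 : 0 <= p by rewrite fine_ge0.
have -> : 2 * (m - a) * (m * p) + (a ^+ 2 - m ^+ 2) * p = (m - a) ^+ 2 * p by ring.
by rewrite mulr_ge0// sqr_ge0.
Qed.

(** The positive function [g - h] has integral at most 0 on [S], hence vanishes almost everywhere
    there; as it vanishes nowhere on [S], the set itself is null. *)
Lemma null_of_le_integral d (X : measurableType d) (R : realType)
    (P : {measure set X -> \bar R}) (S : set X) (g h : X -> R) :
  measurable S -> P.-integrable S (EFin \o g) -> P.-integrable S (EFin \o h) ->
  (forall x, S x -> h x < g x) ->
  (\int[P]_(x in S) (g x)%:E <= \int[P]_(x in S) (h x)%:E)%E -> P S = 0%E.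
Proof.
move=> mS ig ih hg le_gh.
have igh := integrableB mS ig ih.
have : (\int[P]_(x in S) `|(EFin \o g) x - (EFin \o h) x| = 0)%E.
  rewrite (eq_integral (fun x => (EFin \o g) x - (EFin \o h) x)%E); last first.
    move=> x /set_mem Sx; rewrite gee0_abs//= -EFinB lee_fin subr_ge0.
    exact/ltW/hg.
  apply/eqP; rewrite eq_le; apply/andP; split; last first.
    by apply: integral_ge0 => x Sx; rewrite /= -EFinB lee_fin subr_ge0 ltW ?hg.
  by rewrite integralB// sube_le0 //; exact: integrable_fin_num.
move/ae_eq_integral_abs => /(_ mS (measurable_int _ igh)) [N [mN N0 sN]].
apply: (subset_measure0 mS mN _ N0) => x Sx; apply: sN => /= /(_ Sx).
by case=> /eqP; rewrite subr_eq0 gt_eqF ?hg.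
Qed.

Lemma enorm_sqrE (R : realType) (r : nat) (x : 'rV[R]_r) :
  enorm x ^+ 2 = \sum_(j < r) x 0 j ^+ 2.
Proof. by rewrite sqr_sqrtr// sumr_ge0// => j _; rewrite sqr_ge0. Qed.

(** In each coordinate the gap between the two sides is the square of [x 0 j + v 0 j]. *)
Lemma enorm_sqrB_le (R : realType) (r : nat) (x v : 'rV[R]_r) :
  enorm (x - v) ^+ 2 <= 2 * enorm x ^+ 2 + 2 * enorm v ^+ 2.
Proof.
rewrite !enorm_sqrE !mulr_sumr -big_split/=; apply: ler_sum => j _.
by rewrite !mxE; have := sqr_ge0 (x 0 j + v 0 j); nra.
Qed.

(** Open rays generate the Borel sets of the line, and their preimages under a continuous coordinate
    are open. *)
Lemma measurable_coord (R : realType) (r : nat) (j : 'I_r) :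
  measurable_fun (setT : set (borel_rV R r)) (fun x : borel_rV R r => x 0 j).
Proof.
apply: (measurability (@RGenOInfty.G R)) => [|_ [_ [a ->] <-]].
  exact: RGenOInfty.measurableE.
rewrite setTI; apply: sub_sigma_algebra.
apply: (@open_comp _ _ (fun x : 'rV[R]_r => x 0 j)).
  by move=> x _; exact: coord_continuous.
by rewrite set_itvE; exact: open_gt.
Qed.

Section mean_square.
Context {d : measure_display} {X : measurableType d} {R : realType}.
Context {P : probability X R} {r : nat} {A : set X} {phi : X -> 'rV[R]_r}.
Hypothesis mA : measurable A.
Hypothesis mphi : forall j, measurable_fun A (fun t => phi t 0 j).

Lemma measurable_enorm_sqrB (v : 'rV[R]_r) :
  measurable_fun A (fun t => enorm (phi t - v) ^+ 2).
Proof.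
under eq_fun do rewrite enorm_sqrE.
apply: measurable_sum => j; under eq_fun do rewrite !mxE.
apply: measurable_funX; apply: measurable_funB => //.
Qed.

Lemma measurable_enorm_sqr : measurable_fun A (fun t => enorm (phi t) ^+ 2).
Proof.
by have := measurable_enorm_sqrB 0; under eq_fun do rewrite subr0.
Qed.

Hypothesis iphi : P.-integrable A (EFin \o (fun t => enorm (phi t) ^+ 2)).

Lemma integrable_enorm_sqrB (v : 'rV[R]_r) :
  P.-integrable A (EFin \o (fun t => enorm (phi t - v) ^+ 2)).
Proof.
have ic : P.-integrable A (EFin \o cst (2 * enorm v ^+ 2)).
  by apply: finite_measure_integrable_cst.
apply: le_integrable (integrableD mA (integrableZl mA 2 iphi) ic) => //.
  exact/measurable_EFinP/measurable_enorm_sqrB.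
move=> t At /=; rewrite lee_fin ger0_norm ?sqr_ge0// ger0_norm.
  exact: enorm_sqrB_le.
by rewrite addr_ge0// mulr_ge0// sqr_ge0.
Qed.

Lemma integrable_coord_sqr j :
  P.-integrable A (EFin \o (fun t => phi t 0 j ^+ 2)).
Proof.
apply: le_integrable iphi => //.
  by apply/measurable_EFinP; exact: measurable_funX.
move=> t At /=; rewrite lee_fin !ger0_norm ?sqr_ge0//.
rewrite enorm_sqrE (bigD1 j)//= lerDl sumr_ge0// => i _; exact: sqr_ge0.
Qed.

(** The squared Euclidean distance is a sum over coordinates, and the scalar mean is optimal in each
    of them separately. *)
Lemma centroid_min (v : 'rV[R]_r) :
  (\int[P]_(t in A) (enorm (phi t -
      \row_(j < r) ((\int[P]_(t in A) phi t 0 j) / fine (P A))%R) ^+ 2)%:E <=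
   \int[P]_(t in A) (enorm (phi t - v) ^+ 2)%:E)%E.
Proof.
have E w : (\int[P]_(t in A) (enorm (phi t - w) ^+ 2)%:E =
    \sum_(j <- index_enum 'I_r) \int[P]_(t in A) ((phi t 0 j - w 0 j) ^+ 2)%:E)%E.
  rewrite -ge0_integral_sum//; last 2 first.
  - move=> j; apply/measurable_EFinP/measurable_funX.
    exact: measurable_funB.
  - by move=> j t _; rewrite lee_fin sqr_ge0.
  apply: eq_integral => t _; rewrite enorm_sqrE sumEFin; congr EFin.
  by apply: eq_bigr => j _; rewrite !mxE.
rewrite !E; apply: lee_sum => j _; rewrite mxE.
by apply: Rintegral_mean_min => //; exact: integrable_coord_sqr.
Qed.

End mean_square.

(** * Stationarity of local minimisers *)

(** Lloyd's objective, with partition and centres as independent variables; [within_variance] is its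
    value at the conditional means. *)
Definition quantization_cost (R : realType) (d r K : nat) (T : set 'rV[R]_d)
    (P : probability (borel_rV R d) R) (phis : 'rV[R]_d -> 'rV[R]_r)
    (c : 'rV[R]_d -> 'I_K) (q : 'I_K -> 'rV[R]_r) : \bar R :=
  (\int[P]_(t in T) (enorm (phis t - q (c t)) ^+ 2)%:E)%E.

Section lloyd_max_necessity.
Context {R : realType} {d r K : nat}.
Variables (T : set 'rV[R]_d) (P : probability (borel_rV R d) R).
Variable phis : 'rV[R]_d -> 'rV[R]_r.
Hypothesis mT : measurable (T : set (borel_rV R d)).
Hypothesis mphis : forall j,
  measurable_fun (T : set (borel_rV R d)) (fun t : borel_rV R d => phis t 0 j).
Hypothesis iphis : P.-integrable (T : set (borel_rV R d))
  (EFin \o (fun t => enorm (phis t) ^+ 2)).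
Implicit Types (c : 'rV[R]_d -> 'I_K) (q : 'I_K -> 'rV[R]_r).

Lemma bigsetU_cell c : \big[setU/set0]_(k <- index_enum 'I_K) cell T c k = T.
Proof.
rewrite -bigcup_seq; apply/seteqP; split => [t [k _ []]//|t Tt].
by exists (c t); rewrite //= mem_index_enum.
Qed.

Lemma measurable_sub_T (S : set (borel_rV R d)) v :
  measurable S -> S `<=` T ->
  measurable_fun S (fun t : borel_rV R d => enorm (phis t - v) ^+ 2).
Proof.
by move=> mS ST; apply: (measurable_funS mT ST); exact: measurable_enorm_sqrB.
Qed.

Lemma integrable_sub_T (S : set (borel_rV R d)) v :
  measurable S -> S `<=` T ->
  P.-integrable S (EFin \o (fun t : borel_rV R d => enorm (phis t - v) ^+ 2)).
Proof.
by move=> mS ST; apply: (integrableS mT mS ST); exact: integrable_enorm_sqrB.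
Qed.

(** Measurability of [c] is given through its cells, so the integrand is written as a finite sum of
    cell indicators times measurable functions. *)
Lemma measurable_cost c q : K_partition T c ->
  measurable_fun (T : set (borel_rV R d))
    (fun t : borel_rV R d => enorm (phis t - q (c t)) ^+ 2).
Proof.
move=> pc; apply: (eq_measurable_fun (fun t : borel_rV R d =>
    \sum_(k < K) \1_(cell T c k) t * enorm (phis t - q k) ^+ 2)).
  move=> t /set_mem Tt; rewrite (bigD1 (c t))//= big1 ?addr0 => [|k kc].
    by rewrite indicE mem_set ?mul1r.
  by rewrite indicE memNset ?mul0r// => -[_ /esym/eqP]; exact/negP.
apply: measurable_sum => k; apply: measurable_funM.
  by apply: measurable_funTS; exact: measurable_indic.
exact: measurable_enorm_sqrB.
Qed.

Lemma quantization_costE c q : K_partition T c ->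
  quantization_cost T P phis c q =
  (\sum_(k < K) \int[P]_(t in cell T c k) (enorm (phis t - q k) ^+ 2)%:E)%E.
Proof.
move=> pc; rewrite /quantization_cost -{1}(bigsetU_cell c).
rewrite ge0_integral_bigsetU//.
- by apply: eq_bigr => k _; apply: eq_integral => t /set_mem [_ ->].
- exact: index_enum_uniq.
- by move=> i j _ _ [t [[_ <-] [_ <-]]].
- by rewrite bigsetU_cell; apply/measurable_EFinP; exact: measurable_cost.
- by move=> t _; rewrite lee_fin sqr_ge0.
Qed.

(** The cost splits over the cells, and on each cell the conditional mean is the best centre. *)
Lemma within_variance_le_cost c q : K_partition T c ->
  (within_variance T P phis c <= quantization_cost T P phis c q)%E.
Proof.
move=> pc; rewrite -[leLHS]/(quantization_cost T P phis c
  (category_allocation T P phis c)) !quantization_costE//.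
have cellT k : cell T c k `<=` T by move=> t [].
apply: lee_sum => k _; apply: centroid_min => //.
  by move=> j; exact: (measurable_funS mT (cellT k) (mphis j)).
exact: (integrableS mT (pc k) (cellT k) iphis).
Qed.

Lemma quantization_cost_fin c q : K_partition T c ->
  quantization_cost T P phis c q \is a fin_num.
Proof.
move=> pc; rewrite quantization_costE//.
apply/sum_fin_numP => k _ _; apply: (integrable_fin_num (pc k)).
by apply: integrable_sub_T => // t [].
Qed.

Definition recategorise c (S : set 'rV[R]_d) (k : 'I_K) (t : 'rV[R]_d) : 'I_K :=
  if t \in S then k else c t.

(** Every cell loses [S], after which cell [k] receives all of it. *)
Lemma K_partition_recategorise c (S : set (borel_rV R d)) k :
  measurable S -> S `<=` T -> K_partition T c ->
  K_partition T (recategorise c S k).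
Proof.
move=> mS ST pc i.
have -> : cell T (recategorise c S k) i =
    (cell T c i `\` S) `|` (if i == k then S else set0).
  apply/seteqP; split => t; rewrite /cell/recategorise/=.
    move=> [Tt]; case: (pselect (S t)) => St.
      by rewrite mem_set// => <-; right; rewrite eqxx.
    by rewrite memNset// => ci; left.
  move=> [[[Tt ci] St]|]; first by rewrite memNset.
  by case: eqP => [-> St|//]; rewrite mem_set//; split=> //; exact: ST.
apply: measurableU; last by case: ifP.
by apply: measurableD => //; exact: pc.
Qed.

(** At common centres the two costs differ only through their integrals over [S], where moving to
    [k] shortens every distance. *)
Lemma null_nearer c (S : set (borel_rV R d)) j k q :
  K_partition T c -> measurable S -> S `<=` cell T c j ->
  (quantization_cost T P phis c q <=
   quantization_cost T P phis (recategorise c S k) q)%E ->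
  (forall t, S t -> enorm (phis t - q k) < enorm (phis t - q j)) ->
  P S = 0%E.
Proof.
move=> pc mS Sj le_cost nearer.
have ST : S `<=` T by move=> t /Sj[].
have pc' := K_partition_recategorise k mS ST pc.
have split_cost (c' : 'rV[R]_d -> 'I_K) : K_partition T c' ->
    quantization_cost T P phis c' q =
    (\int[P]_(t in T `\` S) (enorm (phis t - q (c' t)) ^+ 2)%:E +
     \int[P]_(t in S) (enorm (phis t - q (c' t)) ^+ 2)%:E)%E.
  move=> pc''; rewrite /quantization_cost -{1}(setDUK ST) setUC.
  rewrite ge0_integral_setU//.
  - exact: measurableD.
  - rewrite setUC setDUK//; apply/measurable_EFinP; exact: measurable_cost.
  - by move=> t _; rewrite lee_fin sqr_ge0.
  - by rewrite disj_set2E setDKI.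
have iS v := integrable_sub_T v mS ST.
apply: (null_of_le_integral mS (iS (q j)) (iS (q k))) => /=.
  move=> t St; rewrite ltr_pXn2r ?nnegrE ?sqrtr_ge0//; exact: nearer.
move: le_cost (quantization_cost_fin q pc); rewrite !split_cost//.
rewrite (eq_integral (mu := P) (D := T `\` S)
  (fun t => (enorm (phis t - q (c t)) ^+ 2)%:E)
  (fun t => (enorm (phis t - q (recategorise c S k t)) ^+ 2)%:E)); last first.
  by move=> t /set_mem [_ St]; rewrite /recategorise memNset.
rewrite (eq_integral (mu := P) (D := S)
  (fun t => (enorm (phis t - q j) ^+ 2)%:E)
  (fun t => (enorm (phis t - q (c t)) ^+ 2)%:E)); last first.
  by move=> t /set_mem /Sj [_ ->].
rewrite (eq_integral (mu := P) (D := S)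
  (fun t => (enorm (phis t - q k) ^+ 2)%:E)
  (fun t => (enorm (phis t - q (recategorise c S k t)) ^+ 2)%:E)); last first.
  by move=> t St; rewrite /recategorise St.
(* The integral over the complement of [S], common to both sides, is a summand of a finite cost and
   may be cancelled. *)
move=> + fin; rewrite leeD2lE//.
by move: fin; rewrite fin_numD => /andP[].
Qed.

End lloyd_max_necessity.

(** * From balls of a fixed radius to the whole space, and necessity *)

Lemma measurable_ball (R : realType) (d : nat) (x : 'rV[R]_d) (e : R) :
  measurable (ball x e : set (borel_rV R d)).
Proof. by apply: sub_sigma_algebra; exact: ball_open. Qed.

(** Balls here are for the sup norm, so rounding each coordinate of [x] down to a multiple of [e]
    moves it by less than [e]. *)
Lemma ball_lattice_point (R : realType) (d : nat) (e : R) (x : 'rV[R]_d) :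
  0 < e -> exists z : 'rV[int]_d, ball (e *: map_mx intr z : 'rV[R]_d) e x.
Proof.
move=> e0; exists (\row_j Num.floor (x 0 j / e)); split=> // i j.
rewrite ord1 !mxE /ball/= /ball_ distrC.
have /andP[] := floor_itv (x 0 j / e).
rewrite intrD ler_pdivlMr// ltr_pdivrMr// mulrDl mul1r => l u.
by rewrite ltr_norml; apply/andP; split; lra.
Qed.

Lemma null_of_locally_null (R : realType) (d : nat)
    (P : {measure set (borel_rV R d) -> \bar R}) (B : set (borel_rV R d))
    (e : R) :
  0 < e -> measurable B ->
  (forall x : 'rV[R]_d, P (B `&` ball x e) = 0%E) -> P B = 0%E.
Proof.
move=> e0 mB B0; apply: measure_negligible => //.
(* Countably many balls, centred on the lattice of mesh [e], cover the space. *)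
pose F n : set (borel_rV R d) := if (unpickle n : option 'rV[int]_d) is Some z
  then B `&` ball (e *: map_mx intr z : 'rV[R]_d) e else set0.
apply: (@negligibleS _ _ _ _ (\bigcup_n F n)).
  move=> x Bx; have [z xz] := ball_lattice_point x e0.
  by exists (pickle z); rewrite // /F pickleK.
apply: negligible_bigcup => n; rewrite /F; case: unpickle => [z|].
  by apply/negligibleP; [apply: measurableI => //; exact: measurable_ball|exact: B0].
exact: negligible_set0.
Qed.

Lemma second_moment_measurable (R : realType) (d r : nat) (T : set 'rV[R]_d)
    (P : probability (borel_rV R d) R) (phis : 'rV[R]_d -> 'rV[R]_r) :
  finite_second_moment T P phis ->
  forall j, measurable_fun (T : set (borel_rV R d))
    (fun t : borel_rV R d => phis t 0 j).
Proof.
by case=> mphi _ j; exact: (measurableT_comp (@measurable_coord R r j) mphi).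
Qed.

Lemma second_moment_integrable (R : realType) (d r : nat) (T : set 'rV[R]_d)
    (P : probability (borel_rV R d) R) (phis : 'rV[R]_d -> 'rV[R]_r) :
  finite_second_moment T P phis ->
  P.-integrable (T : set (borel_rV R d))
    (EFin \o (fun t => enorm (phis t) ^+ 2)).
Proof.
move=> moment2; apply/integrableP; split.
  apply/measurable_EFinP/measurable_enorm_sqr.
  exact: second_moment_measurable moment2.
case: moment2 => _; apply: le_lt_trans; rewrite le_eqVlt; apply/orP; left.
by apply/eqP/eq_integral => t _; rewrite /= ger0_norm// sqr_ge0.
Qed.

Lemma locally_optimal_lloyd_max (R : realType) (d r K : nat) (T : set 'rV[R]_d)
    (P : probability (borel_rV R d) R) (phis : 'rV[R]_d -> 'rV[R]_r)
    (c : 'rV[R]_d -> 'I_K) :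
  measurable (T : set (borel_rV R d)) -> finite_second_moment T P phis ->
  K_partition T c -> locally_optimal T P phis c ->
  lloyd_max T P phis c (category_allocation T P phis c).
Proof.
move=> mT moment2 pc [e e0 opt]; split=> //.
set q := category_allocation T P phis c.
have mcoord := second_moment_measurable moment2.
have iphi := second_moment_integrable moment2.
(* There are finitely many pairs of categories, so their exceptional null sets can be merged. *)
suff ae_jk : forall j k, {ae P, forall t, T t -> c t = j ->
    enorm (phis t - q j) <= enorm (phis t - q k)}.
  have : {ae P, forall t j k, T t -> c t = j ->
      enorm (phis t - q j) <= enorm (phis t - q k)}.
    by apply: filter_forall => j; apply: filter_forall => k; exact: ae_jk.
  by apply: (@filterS _ _ (ae_filter_ringOfSetsType P)) => t near_t Tt k; exact: near_t.
move=> j k.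
pose B := cell T c j `&` [set t : borel_rV R d |
  (enorm (phis t - q k) ^+ 2)%:E < (enorm (phis t - q j) ^+ 2)%:E]%E.
have cellT : cell T c j `<=` T by move=> t [].
have mB : measurable (B : set (borel_rV R d)).
  by apply: measurable_lte => //; try exact: pc;
    apply/measurable_EFinP; exact: (measurable_sub_T mT mcoord).
suff B0 : P B = 0%E.
  exists B; split => // t /= /not_implyP[Tt] /not_implyP[cj] /negP.
  rewrite -ltNge => lt_kj; split => //=.
  by rewrite lte_fin ltr_pXn2r ?nnegrE ?sqrtr_ge0.
apply: (null_of_locally_null e0 mB) => x.
have mS := measurableI _ _ mB (measurable_ball x e).
set S := B `&` ball x e in mS *.
have Sj : S `<=` cell T c j by move=> t [[]].
have ST : S `<=` T by move=> t /Sj[].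
apply: (@null_nearer _ _ _ _ _ P phis mT mcoord iphi c S j k q) => //.
  (* The cost of [c] at [q] is its variance; local optimality bounds it by the competitor's
     variance, which is at most the competitor's cost at the old centres [q]. *)
  have pc' := K_partition_recategorise k mS ST pc.
  apply: le_trans (within_variance_le_cost mT mcoord iphi q pc').
  apply: (opt _ x pc') => t [Tt]; rewrite /recategorise.
  by case: ifPn => [/set_mem[]//|].
by move=> t [[_ /=]]; rewrite lte_fin ltr_pXn2r ?nnegrE ?sqrtr_ge0.
Qed.

(** * A stationary partition that is not locally optimal *)

Lemma is_diff_coord (R : realType) (m n : nat) (M : 'M[R]_(m, n)) i j :
  is_diff M (fun N : 'M[R]_(m, n) => N i j : R) (fun N => N i j).
Proof.
apply: DiffDef; first exact: differentiable_coord.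
have lin : linear (fun N : 'M[R]_(m, n) => N i j : R).
  by move=> a u v; rewrite !mxE.
(* A continuous linear map is its own differential; the coordinate is packed as a linear map to use
   this. *)
pose f : {linear 'M[R]_(m, n) -> R} :=
  HB.pack (fun N : 'M[R]_(m, n) => N i j : R) (GRing.isLinear.Build _ _ _ _ _ lin).
exact: (@diff_lin _ _ _ f M (@coord_continuous _ _ _ _ _)).
Qed.

(** Chosen so that the maximiser is [t] itself, making the identity the oracle allocation, and the
    Hessian is constant. *)
Definition quadratic_utility (R : realType) (t x : 'rV[R]_1) : R :=
  - (x 0 0 - t 0 0) ^+ 2.

Lemma is_diff_quadratic_utility (R : realType) (t x : 'rV[R]_1) :
  is_diff x (quadratic_utility t)
    (fun h => - 2 * (x 0 0 - t 0 0) * h 0 0).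
Proof.
have dc := is_diff_coord x 0 0.
have dB := is_diffB dc (is_diff_cst (t 0 0) x).
rewrite subr0 in dB.
apply: is_diff_eq (is_diffN (is_diffX 1 dB)) _.
apply/funext => h; rewrite !fctE /= expr1 /GRing.scale/=; ring.
Qed.

Lemma gradient_quadratic_utility (R : realType) (t : 'rV[R]_1) :
  gradient (quadratic_utility t) = (- 2) *: (id - cst t).
Proof.
apply/funext => x; apply/rowP => j; rewrite ord1 !mxE.
have dU := is_diff_quadratic_utility t x.
rewrite deriveE; last exact: ex_diff.
by rewrite diff_val !fctE !mxE eqxx mulr1.
Qed.

Lemma is_diff_gradient_quadratic_utility (R : realType) (t x : 'rV[R]_1) :
  is_diff x (gradient (quadratic_utility t)) ((- 2) *: id).
Proof.
rewrite gradient_quadratic_utility.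
have := is_diffZ (- 2) (is_diffB (is_diff_id x) (is_diff_cst t x)).
by rewrite subr0.
Qed.

Lemma hessian_quadratic_utility (R : realType) (t x : 'rV[R]_1) :
  hessian (quadratic_utility t) x = (- 2)%:M.
Proof.
have dG := is_diff_gradient_quadratic_utility t x.
apply/row_matrixP => i; rewrite !rowE /hessian /jacobian mul_rV_lin1.
by rewrite diff_val mul_mx_scalar.
Qed.

Lemma utility_bounds_quadratic (R : realType) (T : set 'rV[R]_1) :
  utility_bounds T (@quadratic_utility R) 2 2.
Proof.
split=> // t _; split.
  split=> x; first exact: (ex_diff (is_diff_def := is_diff_quadratic_utility t x)).
  exact: (ex_diff (is_diff_def := is_diff_gradient_quadratic_utility t x)).
(* With both curvature constants equal to 2, each Loewner difference is the zero matrix. *)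
by move=> x; rewrite hessian_quadratic_utility;
  split=> v; rewrite subrr mulmx0 mul0mx mxE.
Qed.

Lemma oracle_allocation_quadratic (R : realType) (T : set 'rV[R]_1) :
  oracle_allocation T (@quadratic_utility R) id.
Proof.
by move=> t _ x; rewrite /quadratic_utility subrr expr0n oppr0 oppr_le0 sqr_ge0.
Qed.

(** * Uniform laws on finitely many points *)

Section uniform_on_points.
Local Open Scope ereal_scope.
Context {d : measure_display} {X : measurableType d} {R : realType}.
Variables (x : X^nat) (n : nat).

(** The average of the Dirac masses at [x 0], ..., [x n]: there are [n.+1] points, so the
    normalising constant is never zero. *)
Definition uniform_on_points : set X -> \bar R :=
  mscale (n.+1%:R^-1)%:nng%R (msum (fun i => \d_(x i)) n.+1).

HB.instance Definition _ := Measure.on uniform_on_points.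

Lemma uniform_on_pointsE (A : set X) :
  uniform_on_points A = (n.+1%:R^-1)%R%:E * \sum_(i < n.+1) \d_(x i) A.
Proof. by []. Qed.

Let uniform_on_points_setT : uniform_on_points setT = 1.
Proof.
rewrite uniform_on_pointsE (eq_bigr (fun=> 1)) => [|i _]; last by rewrite diracT.
by rewrite sumEFin sumr_const card_ord -EFinM mulVf.
Qed.

HB.instance Definition _ :=
  Measure_isProbability.Build _ _ _ uniform_on_points uniform_on_points_setT.

Lemma integral_uniform_on_points (A : set X) (f : X -> \bar R) :
  measurable A -> measurable_fun A f -> (forall t, A t -> 0 <= f t) ->
  \int[uniform_on_points]_(t in A) f t =
  (n.+1%:R^-1)%R%:E * \sum_(i < n.+1) \d_(x i) A * f (x i).
Proof.
move=> mA mf f0; rewrite ge0_integral_mscale// ge0_integral_measure_sum//.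
by congr (_ * _); apply: eq_bigr => i _; rewrite integral_dirac.
Qed.

End uniform_on_points.

(** * Finite sets of types *)

Section finite_type_set.
Context {R : realType} {d : nat} {T : set 'rV[R]_d}.
Hypothesis finT : finite_set T.

Lemma closed_sub_finite (A : set 'rV[R]_d) : A `<=` T -> closed A.
Proof.
move=> /sub_finite_set/(_ finT).
have /hausdorff_accessible/accessible_finite_set_closed :=
  @norm_hausdorff R 'rV[R]_d.
exact.
Qed.

Lemma measurable_sub_finite (A : set (borel_rV R d)) : A `<=` T -> measurable A.
Proof.
move=> AT; rewrite -[A]setCK; apply: measurableC; apply: sub_sigma_algebra.
by apply: closed_openC; exact: closed_sub_finite.
Qed.

Lemma K_partition_finite K (c : 'rV[R]_d -> 'I_K) : K_partition T c.
Proof. by move=> k; apply: measurable_sub_finite => t []. Qed.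

(** All subsets of a finite [T] are closed, so a cell and its complement in [T] have disjoint
    closures and the relative boundary is empty. *)
Lemma null_cell_boundaries_finite K (P : probability (borel_rV R d) R)
  (c : 'rV[R]_d -> 'I_K) : null_cell_boundaries T P c.
Proof.
move=> k; rewrite (_ : boundary_in _ _ = set0) ?measure0//.
apply/seteqP; split => // t [[_]].
rewrite -!(closure_id _).1; last 2 first.
- by apply: closed_sub_finite => s [].
- by apply: closed_sub_finite => s [].
by move=> tc [_]; apply.
Qed.

End finite_type_set.

Lemma enorm1B (R : realType) (x y : 'rV[R]_1) :
  enorm (x - y) = `|x 0 0 - y 0 0|.
Proof. by rewrite /enorm big_ord1 sqrtr_sqr !mxE. Qed.

(** * The three-point example *)

Section stationary_not_optimal.
Context {R : realType}.

Definition three_types (n : nat) : borel_rV R 1 :=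
  const_mx (nth 0 [:: 0; 2; 3] n).

Definition three_type_set : set 'rV[R]_1 :=
  [set three_types 0; three_types 1; three_types 2].

(** Both partitions of the example are cuts of the line: at 5/2 the cells are {0, 2} and {3}, at 1
    they are {0} and {2, 3}. *)
Definition threshold (s : R) (t : 'rV[R]_1) : 'I_2 :=
  if t 0 0 < s then ord0 else ord_max.

Let T := three_type_set.
Let P : probability (borel_rV R 1) R := uniform_on_points three_types 2.

Lemma finite_three_type_set : finite_set T.
Proof. by rewrite /T /three_type_set !finite_setU; do !split; exact: finite_set1. Qed.

Lemma measurable_three_type_set : measurable (T : set (borel_rV R 1)).
Proof. exact: (measurable_sub_finite finite_three_type_set). Qed.

Lemma integral_three_types (A : set (borel_rV R 1)) (f : borel_rV R 1 -> R) :
  measurable A -> measurable_fun A f -> (forall t, A t -> 0 <= f t) ->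
  (\int[P]_(t in A) (f t)%:E =
   (3^-1 * \sum_(i < 3) \1_A (three_types i) * f (three_types i))%:E)%E.
Proof.
move=> mA mf f0; rewrite integral_uniform_on_points//.
  by rewrite EFinM -sumEFin.
exact/measurable_EFinP.
Qed.

Lemma measurable_coord_id (A : set (borel_rV R 1)) (j : 'I_1) :
  measurable_fun A (fun t : borel_rV R 1 => t 0 j).
Proof. by apply: measurable_funTS; exact: measurable_coord. Qed.

Lemma mem_three_types (i : 'I_3) : T (three_types i).
Proof. by case: i => -[|[|[|//]]] ?; [left; left|left; right|right]. Qed.

Lemma three_types_cost (c : 'rV[R]_1 -> 'I_2) q :
  quantization_cost T P id c q =
  (3^-1 * \sum_(i < 3) (three_types i 0 0 - q (c (three_types i)) 0 0) ^+ 2)%:E.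
Proof.
have pc := K_partition_finite finite_three_type_set c.
rewrite /quantization_cost integral_three_types.
- congr (_ * _)%:E; apply: eq_bigr => i _.
  by rewrite indicE mem_set ?mul1r ?enorm1B ?real_normK ?num_real//; exact: mem_three_types.
- exact: measurable_three_type_set.
- exact: (@measurable_cost R 1 1 2 T id
    (@measurable_coord_id T) c q pc).
- by move=> t _; exact: sqr_ge0.
Qed.

Lemma indic_cell (c : 'rV[R]_1 -> 'I_2) k (i : 'I_3) :
  \1_(cell T c k) (three_types i) = (c (three_types i) == k)%:R :> R.
Proof.
rewrite indicE; congr ((nat_of_bool _)%:R).
apply/idP/eqP => [/set_mem[]//|cik].
by apply: mem_set; split => //; exact: mem_three_types.
Qed.

Lemma three_types_cell (c : 'rV[R]_1 -> 'I_2) k :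
  P (cell T c k) = (3^-1 * \sum_(i < 3) (c (three_types i) == k)%:R)%:E.
Proof.
rewrite -[LHS]mul1e -integral_cst; last exact: (K_partition_finite finite_three_type_set).
rewrite (@integral_three_types _ (cst 1))//; last first.
  exact: (K_partition_finite finite_three_type_set).
by congr (_ * _)%:E; apply: eq_bigr => i _; rewrite mulr1 indic_cell.
Qed.

Lemma three_types_allocation (c : 'rV[R]_1 -> 'I_2) k :
  category_allocation T P id c k 0 0 =
  (\sum_(i < 3) (c (three_types i) == k)%:R * three_types i 0 0) /
  (\sum_(i < 3) (c (three_types i) == k)%:R).
Proof.
rewrite mxE three_types_cell /Rintegral integral_three_types /=.
(* The common weight 1/3 cancels between numerator and denominator. *)
- rewrite invfM invrK mulrACA mulVf// mul1r; congr (_ / _).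
  by apply: eq_bigr => i _; rewrite indic_cell.
- exact: (K_partition_finite finite_three_type_set).
- exact: measurable_coord_id.
- by move=> t [[[->|->]|->] _]; rewrite mxE.
Qed.

Let c := threshold (5 / 2).

Let thresholdE : [/\ threshold (5 / 2) (three_types 0) = ord0,
  threshold (5 / 2) (three_types 1) = ord0 &
  threshold (5 / 2) (three_types 2) = ord_max].
Proof.
rewrite /threshold !mxE/=; split; last first.
  by rewrite ifF//; apply/negbTE; rewrite -leNgt; lra.
  by rewrite ifT//; lra.
by rewrite ifT//; lra.
Qed.

Lemma stationary_allocation0 : category_allocation T P id c ord0 0 0 = 1.
Proof.
rewrite three_types_allocation !big_ord_recr !big_ord0/= /c.
by have [-> -> ->] := thresholdE; rewrite !mxE/=; field.
Qed.

Lemma stationary_allocation1 : category_allocation T P id c ord_max 0 0 = 3.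
Proof.
rewrite three_types_allocation !big_ord_recr !big_ord0/= /c.
by have [-> -> ->] := thresholdE; rewrite !mxE/=; field.
Qed.

Lemma stationary_lloyd_max :
  lloyd_max T P id c (category_allocation T P id c).
Proof.
split=> //; apply: aeW => t; have [e0 e1 e2] := thresholdE.
move=> Tt k; rewrite !enorm1B.
have -> : category_allocation T P id c k 0 0 = if k == ord0 then 1 else 3.
  case: (unliftP ord_max k) => [j|] ->; last exact: stationary_allocation1.
  by rewrite (_ : lift _ _ = ord0) ?stationary_allocation0//; apply/val_inj; case: j => -[].
case: Tt => [[->|->]|->]; rewrite /c ?e0 ?e1 ?e2.
- rewrite stationary_allocation0 mxE/=; case: ifP => _; first exact: lexx.
  by rewrite !ler0_norm; lra.
(* The type 2 is the tie: it lies at distance 1 from both centroids. *)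
- rewrite stationary_allocation0 mxE/=; case: ifP => _; first exact: lexx.
  by rewrite ger0_norm ?ler0_norm; lra.
- by rewrite stationary_allocation1 mxE/= subrr normr0.
Qed.

Lemma stationary_finite_second_moment : finite_second_moment T P id.
Proof.
split; first exact: measurable_id.
rewrite integral_three_types ?ltry//; first exact: measurable_three_type_set.
  exact: (measurable_enorm_sqr (@measurable_coord_id T)).
by move=> t _; exact: sqr_ge0.
Qed.

Lemma stationary_type_distribution : type_distribution T P.
Proof.
split; first exact: measurable_three_type_set.
rewrite [LHS](uniform_on_pointsE three_types 2 T) (eq_bigr (fun=> 1%E)) => [|i _].
  by rewrite sumEFin sumr_const card_ord -EFinM mulVf.
by rewrite diracE mem_set//; exact: mem_three_types.
Qed.

Lemma stationary_positive_cells : positive_cells T P c.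
Proof.
move=> k; rewrite three_types_cell lte_fin mulr_gt0 ?invr_gt0//.
rewrite !big_ord_recr !big_ord0/= /c; have [-> -> ->] := thresholdE.
by case: (unliftP ord_max k) => [[[|//] ?]|] ->; rewrite ?eqxx/= ?addr0 ?add0r.
Qed.

Lemma stationary_not_locally_optimal : ~ locally_optimal T P id c.
Proof.
case=> delta delta0 opt; have [e0 e1 e2] := thresholdE.
have [f0 f1 f2] : [/\ threshold 1 (three_types 0) = ord0,
    threshold 1 (three_types 1) = ord_max &
    threshold 1 (three_types 2) = ord_max].
  rewrite /threshold !mxE/=; split; first by rewrite ifT//; lra.
    by rewrite ifF//; apply/negbTE; rewrite -leNgt; lra.
  by rewrite ifF//; apply/negbTE; rewrite -leNgt; lra.
have pc' := K_partition_finite finite_three_type_set (threshold 1).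
(* Lowering the cut to 1 moves only the type 2, so the change lies in the ball centred there however
   small [delta] is. *)
have := opt (threshold 1) (three_types 1) pc'; apply/not_implyP; split.
  move=> t [Tt]; case: Tt => [[->|->]|->]; rewrite /c ?e0 ?e1 ?e2 ?f0 ?f1 ?f2//.
  by move=> _; exact: ballxx.
apply/negP; rewrite -ltNge.
(* These need not be the new means (the mean of {2, 3} is 5/2): their cost 1/3 bounds the new
   variance and is already below 2/3. *)
pose q' (k : 'I_2) : 'rV[R]_1 := const_mx (if k == ord0 then 0 else 3).
have iT : P.-integrable (T : set (borel_rV R 1))
    (EFin \o (fun t => enorm (id t) ^+ 2)).
  exact: (second_moment_integrable stationary_finite_second_moment).
apply: (@le_lt_trans _ _ (quantization_cost T P id (threshold 1) q')).
  exact: (within_variance_le_cost measurable_three_type_set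
    (@measurable_coord_id T) iT q' pc').
rewrite -[ltRHS]/(quantization_cost T P id c (category_allocation T P id c)).
rewrite !three_types_cost lte_fin !big_ord_recr !big_ord0/= /c.
rewrite e0 e1 e2 f0 f1 f2 stationary_allocation0 stationary_allocation1.
rewrite !mxE/=; lra.
Qed.

End stationary_not_optimal.

Theorem proposition3 (R : realType) :
  (forall (d r K : nat) (T : set 'rV[R]_d)
      (P : probability (borel_rV R d) R)
      (U : 'rV[R]_d -> 'rV[R]_r -> R) (alpha betaU : R)
      (phis : 'rV[R]_d -> 'rV[R]_r) (c : 'rV[R]_d -> 'I_K),
    type_distribution T P ->
    utility_bounds T U alpha betaU ->
    oracle_allocation T U phis ->
    finite_second_moment T P phis ->
    K_partition T c ->
    null_cell_boundaries T P c ->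
    positive_cells T P c ->
    locally_optimal T P phis c ->
    lloyd_max T P phis c (category_allocation T P phis c))
  /\
  (exists (d r K : nat) (T : set 'rV[R]_d)
      (P : probability (borel_rV R d) R)
      (U : 'rV[R]_d -> 'rV[R]_r -> R) (alpha betaU : R)
      (phis : 'rV[R]_d -> 'rV[R]_r) (c : 'rV[R]_d -> 'I_K),
    (type_distribution T P /\ utility_bounds T U alpha betaU /\
     oracle_allocation T U phis /\ finite_second_moment T P phis /\
     K_partition T c /\ null_cell_boundaries T P c /\
     positive_cells T P c) /\
    lloyd_max T P phis c (category_allocation T P phis c) /\
    ~ locally_optimal T P phis c).
Proof.
split.
  move=> d r K T P U alpha betaU phis c [mT _] _ _ moment2 pc _ _ opt.
  exact: locally_optimal_lloyd_max.
have finT := @finite_three_type_set R.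
exists 1, 1, 2, three_type_set, (uniform_on_points three_types 2),
  (@quadratic_utility R), 2, 2, id, (threshold (5 / 2)).
split; last first.
  by split; [exact: stationary_lloyd_max|exact: stationary_not_locally_optimal].
split; first exact: stationary_type_distribution.
split; first exact: utility_bounds_quadratic.
split; first exact: oracle_allocation_quadratic.
split; first exact: stationary_finite_second_moment.
split; first exact: (K_partition_finite finT).
split; first exact: (null_cell_boundaries_finite finT).
exact: stationary_positive_cells.
Qed.
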